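(* For every integer $k\ge 2$ there is a constant $M=M(k)>0$, and for every integer $k\geq 2$ and every $\mu\in(0,1)$ there is $M_0=M_0(k,\mu)$, such that the following holds. Suppose that $G$ is a finite abelian group of order at least $M_0$, and that $A\subseteq G$ is $k$-stable. Then there is a subgroup $H\leq G$ of index at most $\exp(\mu^{-M})$ such that for any $g\in G$, either $|(A-g)\cap H|\leq \mu |H|$ or $|H\setminus (A-g)|\leq \mu|H|$.
   Context: Stability: for a group $G$ (written additively), $A\subseteq G$ and an integer $k\geq 2$, the set $A$ has the $k$-order property if there exist $a_1,\dots,a_k,b_1,\dots,b_k\in G$ such that $a_i+b_j\in A$ if and only if $i\leq j$. The set $A$ is $k$-stable if it does not have the $k$-order property. Notation: $A-g=\{a-g:a\in A\}$. *)

(* Defs.v *)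
From HB Require Import structures.
From mathcomp Require Import all_boot all_order all_algebra all_fingroup.
From mathcomp Require Import all_classical all_reals all_analysis.

Set Implicit Arguments.
Unset Strict Implicit.
Unset Printing Implicit Defensive.

Import GRing.Theory.
Local Open Scope ring_scope.

Definition k_order_property (G : finZmodType) (k : nat) (A : {set G}) : Prop :=
  exists a b : 'I_k -> G, forall i j : 'I_k, a i + b j \in A <-> (i <= j)%N.

Definition k_stable (G : finZmodType) (k : nat) (A : {set G}) : Prop :=
  ~ k_order_property k A.

Definition translate (G : finZmodType) (A : {set G}) (g : G) : {set G} :=
  [set a - g | a in A].

(* Main.v *)
(** Call [X] good when every translate of [A] contains almost all or almost none
    of [X].  A set which is not good is split by some translate of [A] into two
    parts of comparable size; stability bounds the height of a binary tree of such
    splittings, so a good [X] occurs after boundedly many steps.  The tolerance may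
    be taken proportional to the density of [X] itself, at the cost of squaring the
    density at each step.
    Let [D] be the set of [g] for which [A - g] contains almost all of [X], and let
    [H] be the stabilizer of [D].  If [h] is not in [H] then [X] and [X - h] are
    almost disjoint; averaging over [h] yields [#|X| <= 2 #|H|].  Finally some coset
    of [H] carries its fair share of [X], and averaging over that coset transfers
    the dichotomy from [X] to [H]. *)
Require Import Defs.
From HB Require Import structures.
From mathcomp Require Import all_boot all_order all_algebra all_fingroup.
From mathcomp Require Import all_classical all_reals all_analysis.
From mathcomp Require Import zify ring lra.

Set Implicit Arguments.
Unset Strict Implicit.
Unset Printing Implicit Defensive.

Import Order.TTheory GRing.Theory Num.Theory.
Local Open Scope ring_scope.

(** * Binary trees of splittings and the ladders inside them *)

(** [P] collects the conditions met along a branch, so a leaf only asks for a point satisfying all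
    of them; nodes on one level may carry different labels. *)
Fixpoint split_tree (T U : Type) (E : T -> U -> bool) (h : nat)
    (N : pred U) (P : pred T) : Prop :=
  if h is h'.+1 then
    exists g, [/\ N g, split_tree E h' N (fun x => P x && E x g)
                & split_tree E h' N (fun x => P x && ~~ E x g)]
  else exists x, P x.

Lemma split_tree_sub (T U : Type) (E : T -> U -> bool) h
    (N N' : pred U) (P P' : pred T) :
  (forall g, N g -> N' g) -> (forall x, P x -> P' x) ->
  split_tree E h N P -> split_tree E h N' P'.
Proof.
move=> sN; elim: h P P' => [|h IH] P P' sP /=.
  by case=> x /sP; exists x.
case=> g [/sN Ng T1 T0]; exists g; split=> //.
  by apply: IH T1 => x /andP[/sP -> ->].
by apply: IH T0 => x /andP[/sP -> ->].
Qed.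

Lemma split_tree_leaf (T U : Type) (E : T -> U -> bool) h
    (N : pred U) (P : pred T) :
  split_tree E h N P -> exists x, P x.
Proof.
elim: h P => [//|h IH] P /= [g [_ /IH[x /andP[Px _]] _]].
by exists x.
Qed.

(** Induction on [p + q]. If [C] holds at the root, either both subtrees yield a [C]-coloured tree
    of height one less, and the root joins them, or one of them already yields the second
    alternative. The other colour is symmetric. *)
Lemma split_tree_ramsey (T U : Type) (E : T -> U -> bool) (C N : pred U) p q
    (P : pred T) :
  split_tree E (p + q) N P ->
  split_tree E p (fun g => N g && C g) P \/
  split_tree E q (fun g => N g && ~~ C g) P.
Proof.
move: {2}(p + q)%N (erefl (p + q)%N) => n.
elim: n p q P => [|n IH] [|p] [|q] P // En; try by move/split_tree_leaf; auto.
rewrite En => -[g [Ng T1 T0]].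
have subl x : P x && E x g -> P x by case/andP.
have subr x : P x && ~~ E x g -> P x by case/andP.
case: (boolP (C g)) => Cg.
- have En' : (p + q.+1)%N = n by lia.
  rewrite -En' in T1 T0.
  case: (IH _ _ _ En' T1) => [T1'|T1']; last first.
    by right; apply: split_tree_sub T1'.
  case: (IH _ _ _ En' T0) => [T0'|T0']; last first.
    by right; apply: split_tree_sub T0'.
  by left; exists g; rewrite Ng Cg.
- have En' : (p.+1 + q)%N = n by lia.
  rewrite -En' in T1 T0.
  case: (IH _ _ _ En' T1) => [T1'|T1'].
    by left; apply: split_tree_sub T1'.
  case: (IH _ _ _ En' T0) => [T0'|T0'].
    by left; apply: split_tree_sub T0'.
  by right; exists g; rewrite Ng Cg.
Qed.

(** One level for the root and [2m + 1] for the two colours; in closed form [2^(k+1) - 2]. *)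
Fixpoint ladder_height (k : nat) : nat :=
  if k is k'.+1 then (ladder_height k').*2.+2 else 0.

(* Hodges' argument: a leaf [x] below the root [g] colours the nodes by [E x].  A
   large true-coloured subtree goes to the right of the new rung formed by [x] and
   the root of that subtree; a large false-coloured one goes to the left of the
   rung [(x, g)]. *)
Lemma split_tree_ladder (T U : Type) (E : T -> U -> bool) k
    (N : pred U) (P : pred T) :
  split_tree E (ladder_height k) N P -> (0 < k)%N ->
  exists (a : nat -> T) (b : nat -> U),
    [/\ forall i, (i < k)%N -> P (a i),
        forall j, (j < k)%N -> N (b j)
      & forall i j, (i < k)%N -> (j < k)%N -> E (a i) (b j) = (i <= j)%N].
Proof.
elim: k N P => [//|k IH] N P [g [Ng T1 _]] _.
have {}T1 : split_tree E (ladder_height k).*2.+1 N (fun x => P x && E x g).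
  exact: T1.
have [x /andP[Px Exg]] := split_tree_leaf T1.
case: (posnP k) => [->|k0].
  exists (fun=> x), (fun=> g); split=> // i j.
  by rewrite !ltnS !leqn0 => /eqP-> /eqP->.
set m := ladder_height k in IH T1 *.
(* The true colour gets one level more, since the root [g'] of its tree is spent on the new rung. *)
have Em : m.*2.+1 = (m.+1 + m)%N by rewrite -addnn.
rewrite Em in T1.
case: (split_tree_ramsey (E x) T1) => [[g' [/andP[Ng' Exg'] _ T0]]|T'].
- have [a [b [Pa Nb Eab]]] := IH _ _ T0 k0.
  exists (fun i => if i is i'.+1 then a i' else x).
  exists (fun j => if j is j'.+1 then b j' else g').
  split.
  + by case=> // i /Pa /andP[/andP[]].
  + by case=> // j /Nb /andP[].
  + case=> [|i] [|j] //= ik jk; last exact: Eab.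
      by have /andP[_ ->] := Nb _ jk.
    by have /andP[_ /negbTE->] := Pa _ ik.
- have [a [b [Pa Nb Eab]]] := IH _ _ T' k0.
  exists (fun i => if (i < k)%N then a i else x).
  exists (fun j => if (j < k)%N then b j else g).
  split.
  + by move=> i _; case: ifP => // /Pa /andP[].
  + by move=> j _; case: ifP => // /Nb /andP[].
  + move=> i j ik jk; case: ifP => ik'; case: ifP => jk'.
    * exact: Eab.
    * by have /andP[_ ->] := Pa _ ik'; lia.
    * by have /andP[_ /negbTE->] := Nb _ jk'; lia.
    * by rewrite Exg; lia.
Qed.

Lemma stable_no_tree (G : finZmodType) k (A : {set G}) : (0 < k)%N ->
  k_stable k A ->
  ~ split_tree (fun x g => x + g \in A) (ladder_height k) predT predT.
Proof.
move=> k0 stA /split_tree_ladder /(_ k0) [a [b [_ _ Eab]]]; apply: stA.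
exists (fun i => a i), (fun j => b j) => i j.
by rewrite Eab.
Qed.


(** * Translates and stabilizers *)

Section Translate.
Variable G : finZmodType.
Implicit Types (X Y B : {set G}) (g h x : G).

Lemma mem_translate Y g h : (h \in translate Y g) = (h + g \in Y).
Proof.
apply/imsetP/idP => [[a aY ->]|hY]; first by rewrite subrK.
by exists (h + g); rewrite ?addrK.
Qed.

Lemma card_translate Y g : #|translate Y g| = #|Y|.
Proof. by rewrite card_imset //; apply: addIr. Qed.

Lemma translateC Y g : translate (~: Y) g = ~: translate Y g.
Proof. by apply/setP => h; rewrite inE !mem_translate inE. Qed.

(** Both sides count the pairs of [h] in [Y] and [x] in [X] with [x + h] in [B]. *)
Lemma sum_card_translate X Y B :
  (\sum_(h in Y) #|X :&: translate B h| = \sum_(x in X) #|Y :&: translate B x|)%N.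
Proof.
have E U g : #|U :&: translate B g| = (\sum_(x in U) (x + g \in B)%R)%N.
  rewrite -sum1_card big_mkcond [RHS]big_mkcond; apply: eq_bigr => x _.
  by rewrite inE mem_translate; case: (x \in U); case: (_ \in B).
under eq_bigr do rewrite E; rewrite exchange_big; apply: eq_bigr => x _.
by rewrite E; apply: eq_bigr => h _; rewrite addrC.
Qed.

Lemma sum_card_translateT X Y :
  (\sum_h #|X :&: translate Y h| = #|X| * #|Y|)%N.
Proof.
have -> : (\sum_h #|X :&: translate Y h| =
           \sum_(h in [set: G]) #|X :&: translate Y h|)%N.
  by apply: eq_bigl => h; rewrite inE.
rewrite sum_card_translate; under eq_bigr do rewrite finset.setTI card_translate.
by rewrite sum_nat_const.
Qed.

Lemma translate_addr_group (H : {group G}) B s g : s \in H ->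
  #|H :&: translate B (s + g)| = #|H :&: translate B g|.
Proof.
move=> sH; rewrite -(card_translate (H :&: translate B g) s).
apply: eq_card => h; rewrite mem_translate !inE !mem_translate addrA.
by congr (_ && _); rewrite -[h + s]/(h * s)%g groupMr.
Qed.

Definition stabilizer B : {set G} := [set h | translate B h == B].

Lemma stabilizer_group_set B : group_set (stabilizer B).
Proof.
apply/group_setP; split.
  rewrite inE; apply/eqP/setP => g.
  by rewrite mem_translate -[1%g]/(0 : G) addr0.
move=> h h'; rewrite !inE => /eqP Eh /eqP Eh'; apply/eqP/setP => g.
rewrite mem_translate -[(h * h')%g]/(h + h') addrA addrAC.
by rewrite -mem_translate Eh -mem_translate Eh'.
Qed.

Definition stabilizer_group B := Group (stabilizer_group_set B).

End Translate.

(** * Good sets and the stabilizer of the majority set *)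

Section Good.
Variables (R : realType) (G : finZmodType) (A : {set G}).
Implicit Types (X P : {set G}) (q : R).

Let natr_order_gt0 : 0 < #|G|%:R :> R.
Proof. by rewrite ltr0n; apply/card_gt0P; exists 0. Qed.

(* [q] times the density of [X] in [G], times [#|X|]. *)
Definition tolerance q X : R := q * #|X|%:R ^+ 2 / #|G|%:R.

Definition good q X : bool :=
  [forall g, (#|X :&: translate A g|%:R <= tolerance q X)
          || (#|X :&: translate (~: A) g|%:R <= tolerance q X)].

(** Splitting turns a density of at least [q^e] into one of at least [q^(2e+1)]. Thus [e + 1]
    doubles at each level, which gives the exponent. *)
Lemma good_or_tree q h e P : 0 < q -> q <= 1 ->
  q ^+ e * #|G|%:R <= #|P|%:R ->
  split_tree (fun x g => x + g \in A) h predT (mem P) \/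
  exists2 X, good q X & q ^+ (2 ^ h * e.+1) * #|G|%:R <= #|X|%:R.
Proof.
move=> q0 q1; elim: h e P => [|h IH] e P leP.
  left=> /=; apply/card_gt0P; rewrite -(ltr0n R).
  by apply: lt_le_trans leP; rewrite mulr_gt0 ?exprn_gt0.
have [gP|] := boolP (good q P).
  right; exists P => //; apply: le_trans leP; rewrite ler_pM2r //.
  apply: ler_wiXn2l => //; first exact: ltW.
  by rewrite (leq_trans (leqnSn e)) // leq_pmull // expn_gt0.
rewrite negb_forall => /existsP[g]; rewrite negb_or -!ltNge => /andP[P1 P0].
have step (Y : {set G}) : tolerance q P < #|Y|%:R ->
    q ^+ e.*2.+1 * #|G|%:R <= #|Y|%:R.
  rewrite /tolerance ltr_pdivrMr // => ltY.
  rewrite -(ler_pM2r natr_order_gt0); apply/ltW; apply: le_lt_trans ltY.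
  rewrite exprS -!mulrA ler_pM2l // -muln2 exprM.
  rewrite -expr2 -exprMn ler_sqr ?nnegrE //.
  by rewrite mulr_ge0 ?exprn_ge0 // ltW.
have Eexp : (2 ^ h * e.*2.+2 = 2 ^ h.+1 * e.+1)%N.
  by rewrite expnS; lia.
have := IH _ _ (step _ P1); rewrite Eexp => -[T1|]; last by right.
have := IH _ _ (step _ P0); rewrite Eexp => -[T0|]; last by right.
left; exists g; split=> //.
  by apply: split_tree_sub T1 => // x /=; rewrite inE mem_translate.
by apply: split_tree_sub T0 => // x /=; rewrite inE mem_translate inE.
Qed.

Definition majority q X : {set G} :=
  [set g | #|X :&: translate (~: A) g|%:R <= tolerance q X].

Lemma goodN_majority q X g : good q X -> g \notin majority q X ->
  #|X :&: translate A g|%:R <= tolerance q X.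
Proof. by move=> /forallP/(_ g)/orP[//|]; rewrite inE => ->. Qed.

(** Some [g] has exactly one of [g], [g + h] in [D]. For [x] in [X] and [X - h], whichever side of
    [A] contains [x + h + g], either [x] is exceptional for [g + h] or [x + h] is exceptional for
    [g]. *)
Lemma stabilizer_majorityN q X h : good q X ->
  h \notin stabilizer (majority q X) ->
  #|X :&: translate X h|%:R <= 2 * tolerance q X.
Proof.
move=> gX; set D := majority q X.
have sub B g : #|X :&: translate (~: B) (h + g)|%:R <= tolerance q X ->
    #|X :&: translate B g|%:R <= tolerance q X ->
    #|X :&: translate X h|%:R <= 2 * tolerance q X.
  move=> le1 le2; rewrite mulr2n mulrDl mul1r.
  apply: le_trans (lerD le1 le2); rewrite -natrD ler_nat.
  rewrite -[X in (_ <= _ + X)%N](card_translate _ h).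
  apply: leq_trans (leq_card_setU _ _); apply: subset_leq_card.
  apply/fintype.subsetP => x; rewrite !inE !mem_translate !inE !mem_translate.
  by rewrite addrA => /andP[-> ->] /=; rewrite orNb.
rewrite inE => neD; have [g neg] : exists g, (g + h \in D) != (g \in D).
  apply/existsP; rewrite -negb_forall; apply: contra neD => /forallP eqD.
  by apply/eqP/setP => g; rewrite mem_translate; apply/eqP.
case: (boolP (g \in D)) neg => gD neg.
  apply: (sub (~: A) g); last by rewrite inE in gD.
  rewrite finset.setCK addrC; apply: goodN_majority => //.
  by move: neg; case: (_ \in _).
apply: (sub A g); last exact: goodN_majority gD.
by rewrite addrC; move: neg; case: (boolP (_ \in D)); rewrite // inE.
Qed.

(** The sum of [#|X :&: (X - h)|] over all [h] is [#|X|^2]. Terms outside [H] add up to at most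
    [2q #|X|^2], hence to at most half of it; terms in [H] are at most [#|X|] each. *)
Lemma card_stabilizer_majority q X : good q X -> 0 <= q -> 4 * q <= 1 ->
  #|X|%:R <= 2 * #|stabilizer (majority q X)|%:R :> R.
Proof.
move=> gX q0 q4; set H := stabilizer _.
have [->|X0] := eqVneq X finset.set0; first by rewrite cards0 mulr_ge0.
have {}X0 : 0 < #|X|%:R :> R by rewrite ltr0n card_gt0.
have := sum_card_translateT X X => /(congr1 (fun n => n%:R : R)).
rewrite natrM natr_sum (bigID (mem H)) /= => EX.
have le1 : \sum_(h in H) #|X :&: translate X h|%:R <= #|H|%:R * #|X|%:R :> R.
  rewrite mulr_natl -sumr_const; apply: ler_sum => h _.
  by rewrite ler_nat subset_leq_card // finset.subsetIl.
have le2 : \sum_(h | h \notin H) #|X :&: translate X h|%:R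
    <= 2 * q * #|X|%:R ^+ 2 :> R.
  have -> : 2 * q * #|X|%:R ^+ 2 = \sum_(h : G) 2 * tolerance q X.
    rewrite sumr_const -mulr_natl /tolerance; field; exact: lt0r_neq0.
  apply: le_trans (_ : \sum_(h | h \notin H) 2 * tolerance q X <= _).
    by apply: ler_sum => h; apply: stabilizer_majorityN.
  rewrite [leRHS](bigID (mem H)) /= lerDr sumr_ge0 // => h _.
  by rewrite /tolerance mulr_ge0 // divr_ge0 // mulr_ge0 // exprn_ge0.
have le3 : 2 * q * #|X|%:R <= #|X|%:R / 2 :> R by nra.
rewrite -(ler_pM2r X0); nra.
Qed.

Lemma popular_coset (H : {group G}) X :
  exists u, (#|X| * #|H| <= #|X :&: translate H u| * #|G|)%N.
Proof.
have [u _ maxu] := arg_maxnP (i0 := 0 : G) (P := xpredT)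
  (fun v => #|X :&: translate H v|) isT.
exists u; rewrite -sum_card_translateT mulnC -sum_nat_const.
by apply: leq_sum => v _; apply: maxu.
Qed.

(** Count pairs of [h] in [H] and [x] in [X] with [x + h + u + g] in [B]. Each [h] contributes at
    most [c]; each [x] in [H - u] contributes exactly [#|H :&: (B - g)|], as [x + u] lies in [H]. *)
Lemma coset_average (H : {group G}) X B u g (c : R) :
  (#|X| * #|H| <= #|X :&: translate H u| * #|G|)%N ->
  (forall h, h \in H -> #|X :&: translate B (h + (u + g))|%:R <= c) ->
  #|H :&: translate B g|%:R * #|X|%:R <= c * #|G|%:R.
Proof.
move=> leu lec; have H0 : 0 < #|H|%:R :> R by rewrite ltr0n cardG_gt0.
have le1 : (#|X :&: translate H u| * #|H :&: translate B g|
            <= \sum_(h in H) #|X :&: translate B (h + (u + g))%R|)%N.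
  have E h : translate B (h + (u + g)) = translate (translate B (u + g)) h.
    by apply/setP => x; rewrite !mem_translate addrA.
  under eq_bigr do rewrite E.
  rewrite sum_card_translate -sum_nat_const.
  (* Points of [X] outside [H - u] are discarded. *)
  rewrite [leqRHS](bigID (mem (translate H u))) /=.
  apply: leq_trans (leq_addr _ _).
  under [leqRHS]eq_bigl do rewrite -finset.in_setI.
  apply: leq_sum => x; rewrite inE mem_translate => /andP[_ xuH].
  by rewrite -E addrA translate_addr_group.
have le2 : (\sum_(h in H) #|X :&: translate B (h + (u + g))%R|)%N%:R
           <= #|H|%:R * c.
  by rewrite natr_sum mulr_natl -sumr_const; apply: ler_sum.
rewrite -(ler_pM2r H0).
have /= := leq_mul (leqnn #|H :&: translate B g|) leu.
rewrite -(ler_nat R) !natrM => le3.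
rewrite -mulrA; apply: le_trans le3 _.
move: le1; rewrite -(ler_nat R) natrM => /le_trans/(_ le2) le1.
have := ler_wpM2r (ltW natr_order_gt0) le1.
by rewrite -mulrA -!(mulrCA #|_ :&: translate B g|%:R) -mulrA (mulrC _ #|H|%:R) mulrA.
Qed.

(** [D] is invariant under [H], so one alternative holds for all translates by [h + (u + g)], and
    averaging gives the bound [q #|X|]. *)
Lemma good_stabilizer q X g : good q X -> 0 <= q -> 4 * q <= 1 ->
  (0 < #|X|)%N ->
  let H := stabilizer_group (majority q X) in
  #|H :&: translate A g|%:R <= 2 * q * #|H|%:R \/
  #|H :&: translate (~: A) g|%:R <= 2 * q * #|H|%:R.
Proof.
move=> gX q0 q4 X0 H; set D := majority q X.
have leX : #|X|%:R <= 2 * #|H|%:R :> R by apply: card_stabilizer_majority.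
have [u leu] := popular_coset H X.
have stabD h : h \in H -> (h + (u + g) \in D) = (u + g \in D).
  by rewrite inE -/D => /eqP {2}<-; rewrite mem_translate addrC.
have conclude B :
    (forall h, h \in H -> #|X :&: translate B (h + (u + g))|%:R <= tolerance q X) ->
    #|H :&: translate B g|%:R <= 2 * q * #|H|%:R.
  move=> /(coset_average leu).
  rewrite /tolerance divfK ?lt0r_neq0 // expr2 mulrA ler_pM2r ?ltr0n // => le.
  by apply: le_trans le _; rewrite (mulrC 2) -mulrA ler_wpM2l.
case: (boolP (u + g \in D)) => ugD; [right|left]; apply: conclude => h hH.
  by move: ugD; rewrite -(stabD h hH) inE.
by apply: goodN_majority => //; rewrite stabD.
Qed.

End Good.

(** * Choice of constants and the index bound *)

Unset Implicit Arguments.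

Theorem theorem4 (R : realType) (k : nat) (hk : (2 <= k)%N) :
  exists M : R, 0 < M /\
    forall mu : R, 0 < mu -> mu < 1 ->
    exists M0 : nat,
      forall (G : finZmodType) (A : {set G}),
        (M0 <= #|G|)%N -> k_stable k A ->
        exists H : {group G},
          (#|[set: G] : H|%g)%:R <= expR (mu `^ (- M)) /\
          forall g : G,
            #|translate A g :&: H|%:R <= mu * #|H|%:R \/
            #|H :\: translate A g|%:R <= mu * #|H|%:R.
Proof.
set E := (2 ^ ladder_height k)%N.
(* The index is at most [2 / q^E] with [q = mu / 2]. As [mu < 1/2], [q] is at least [mu^2], and one
   more factor [mu] absorbs the [2]. *)
exists (E.*2.+1)%:R; split; first by rewrite ltr0n.
move=> mu mu0 mu1; exists 0%N => G A _ stA.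
(* For [mu] at least [1/2] the whole group works: a set or its complement has at most half the
   elements. *)
have [mu_ge|mu_lt] := lerP 1 (mu * 2).
  exists [set: G]%G; split.
    by rewrite indexgg -expR0 ler_expR powR_ge0.
  move=> g; have := cardsID (translate A g) [set: G].
  rewrite finset.setIC => /(congr1 (fun n => n%:R : R)); rewrite natrD.
  have [le _|lt /= Esum] := lerP #|translate A g :&: [set: G]|%:R (mu * #|[set: G]|%:R).
    by left.
  right; have t0 : 0 <= (mu * 2 - 1) * #|[set: G]|%:R :> R.
    by rewrite mulr_ge0 // subr_ge0.
  lra.
pose q := mu / 2.
have q0 : 0 < q by rewrite /q; lra.
have q1 : q <= 1 by rewrite /q; lra.
have q4 : 4 * q <= 1 by rewrite /q; lra.
have leG : q ^+ 0 * #|G|%:R <= #|[set: G]|%:R by rewrite expr0 mul1r cardsT.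
case: (good_or_tree A (ladder_height k) q0 q1 leG) => [T|[X gX]].
  by case: (stable_no_tree (ltnW hk) stA); apply: split_tree_sub T.
rewrite muln1 -/E => leX.
have G0 : (0 < #|G|)%N by apply/card_gt0P; exists 0.
have X0 : (0 < #|X|)%N.
  by rewrite -(ltr0n R); apply: lt_le_trans leX; rewrite mulr_gt0 ?exprn_gt0 ?ltr0n.
exists (stabilizer_group (majority A q X)); split; last first.
  move=> g; have Emu : 2 * q = mu by rewrite /q; field.
  rewrite finset.setIC finset.setDE -translateC -Emu.
  exact: (good_stabilizer g gX (ltW q0) q4 X0).
have := card_stabilizer_majority gX (ltW q0) q4.
set H := stabilizer_group _ => leH.
have H0 : 0 < #|H|%:R :> R by rewrite ltr0n cardG_gt0.
have := Lagrange (finset.subsetT H); rewrite cardsT => EG.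
set idx := #|[set: G] : H|%g in EG *.
have le2 : q ^+ E * idx%:R <= 2.
  rewrite -(ler_pM2r H0); apply: le_trans leH; apply: le_trans leX.
  by rewrite -EG natrM mulrA mulrAC.
have le1 : mu ^+ E.*2.+1 * idx%:R <= 1.
  have leq : mu ^+ E.*2 <= q ^+ E.
    rewrite -mul2n exprM lerXn2r ?nnegrE ?exprn_ge0 ?ltW //.
    by rewrite /q; nra.
  rewrite exprS -mulrA.
  have : mu ^+ E.*2 * idx%:R <= 2 :> R.
    by apply: le_trans le2; rewrite ler_wpM2r.
  nra.
apply: (@le_trans _ _ (mu `^ - (E.*2.+1)%:R)).
  rewrite powRN (powR_mulrn _ (ltW mu0)) -div1r ler_pdivlMr ?exprn_gt0 //.
  by rewrite mulrC.
(* The index is already at most [mu^(-M)], and [t <= 1 + t <= exp t]. *)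
by apply: le_trans (expR_ge1Dx _); rewrite lerDr.
Qed.
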